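(* There exists an absolute constant $K>0$ such that the following holds. Let $p=p(n)\in[0,1]$ be any function of $n$ satisfying $p(n)\geq \frac{K\log n}{n^2}$ for all sufficiently large $n$ divisible by $4$. Then $$\lim_{\substack{n\to\infty\\ 4\mid n}}\Pr\left(H_{n,p;3}\text{ contains a loose Hamilton cycle}\right)=1,$$ where the limit is taken over positive integers $n$ divisible by $4$.
   Context: A $3$-uniform hypergraph is a pair $H=(V,E)$ with $E\subseteq\binom{V}{3}$, where $\binom{V}{3}$ denotes the set of $3$-element subsets of $V$. The random hypergraph $H_{n,p;3}$ has vertex set $V=[n]=\{1,\ldots,n\}$, and each of the $\binom{n}{3}$ possible edges (triples) is included independently with probability $p$. A loose Hamilton cycle in a $3$-uniform hypergraph $H=(V,E)$ is a sub-hypergraph $C$ of $H$ for which there is a cyclic ordering of the vertices $V$ such that every edge of $C$ consists of $3$ consecutive vertices and every pair of consecutive edges $E_{i-1},E_i$ of $C$ (in the natural cyclic ordering of the edges) satisfies $|E_{i-1}\setminus E_i|=2$, i.e. consecutive edges share exactly one vertex. Equivalently, for $|V|=n$ even (and $n\geq 6$), it is a sequence of edges $\{x_i,y_i,x_{i+1}\}\in E$, $i=1,2,\ldots,n/2$, with $x_{n/2+1}=x_1$, where $x_1,\ldots,x_{n/2},y_1,\ldots,y_{n/2}$ are distinct and together are all the vertices of $V$. $\log$ denotes the natural logarithm. *)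

(* Defs.v *)
(* MathComp + MathComp-Analysis *)
From HB Require Import structures.
From mathcomp Require Import all_boot all_order all_algebra.
From mathcomp Require Import all_classical all_reals all_analysis.
Set Implicit Arguments.
Unset Strict Implicit.
Unset Printing Implicit Defensive.
Import Order.TTheory GRing.Theory Num.Theory.
Import numFieldNormedType.Exports.
Local Open Scope ring_scope.

Definition triples (V : finType) : {set {set V}} :=
  [set e : {set V} | #|e| == 3%N].

(* A 3-uniform hypergraph on V is represented by its edge set, a subset of
   [triples V]. *)
Definition uniform3 (V : finType) (E : {set {set V}}) : bool :=
  E \subset triples V.

(* [C] consists of the edges {x_i, y_i, x_(i+1)}, i ranging cyclically over
   |V|/2 indices ([ordS] is the cyclic successor), where the x_i and y_i are
   distinct and together exhaust V; exhaustion rules out odd |V|.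
   This is the usual notion of loose Hamilton cycle when |V| >= 6. *)
Definition loose_Hamilton_cycle (V : finType) (C : {set {set V}}) : bool :=
  [exists x : {ffun 'I_(#|V|./2) -> V}, exists y : {ffun 'I_(#|V|./2) -> V},
    [&& injectiveb x, injectiveb y,
        [forall i, forall j, x i != y j],
        [forall v, (v \in codom x) || (v \in codom y)]
      & C == [set [set x i; y i; x (ordS i)] | i : 'I_(#|V|./2)]]].

Definition has_loose_Hamilton_cycle (V : finType) (E : {set {set V}}) : bool :=
  [exists C : {set {set V}}, (C \subset E) && loose_Hamilton_cycle C].

(* Probability that the random hypergraph H_{n,p;3} has property [Q]; the n
   vertices are 0, ..., n-1. The weight of E is its probability when each
   triple is an edge independently with probability p. *)
Definition Pr_H3 (R : realType) (n : nat) (p : R)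
    (Q : pred {set {set 'I_n}}) : R :=
  \sum_(E : {set {set 'I_n}} | uniform3 E && Q E)
    \prod_(e in triples 'I_n) (if e \in E then p else 1 - p).

(* Main.v *)
Require Import Defs.
From HB Require Import structures.
From mathcomp Require Import all_boot all_order all_algebra all_fingroup.
From mathcomp Require Import all_classical all_reals all_analysis.
From mathcomp Require Import zify ring lra.
From mathcomp Require Import fintype bigop finset.
Import Order.TTheory GRing.Theory Num.Theory.
Import numFieldNormedType.Exports.

Set Implicit Arguments.
Unset Strict Implicit.
Unset Printing Implicit Defensive.

(** A random hypergraph contains a loose Hamilton cycle because the set of all
loose Hamilton cycles is spread: no small set of triples lies in more than its
fair share of them.

Split the [n = 2m] vertices into two halves, enumerated by [x] and [y].  A pair
[w] of permutations of ['I_m] gives a loose Hamilton cycle whose [i]-th edge is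
[{x (w.1 i), y (w.2 i), x (w.1 (i+1))}].  Call a family of sets [q]-spread if at
most a fraction [q ^ |A|] of its members contain [A], for every set [A].  The
[m! ^ 2] cycles above are [O(1/n^2)]-spread ([loose_cycle_spread]).  This is
counted by a switching argument ([card_containing_setU1]): in a cycle containing
[A] and one more edge [e], exchange the middle vertex of [e] with that of
another edge outside [A], then cut [e] and an edge outside [A] out of the cycle
and reconnect the two arcs after reversing one of them.  There are about
[(m - |A|)^2] choices, and the result, still containing [A], together with one
bit determines the cycle and the choices.  So each further edge costs a factor
[O((m - |A|)^-2)].

The rest is general: if a family of sets of size at most [l] is [q]-spread, then
a random set of density [O(q log l)] contains one of them with probability close
to 1 ([spread_lemma]).  Expose the random set in about [log l] rounds.  After
exposing [W], replace each member [S i] by a minimum fragment: a smallest set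
[S j :\: W] with [S j] inside [W :|: S i].  Fragments lie inside the [S i], so
they are spread again, and it is enough that the later rounds contain one of
them.  A round of density [64 q] leaves few fragments of more than half of the
former size ([fragment_loss]): given [Z = W :|: F] with [F] a fragment, [F] is a
subset of any member of the family inside [Z], so there are at most [2 ^ l]
possible [F], whereas moving [F] from the family to the random set gains a
factor [64] for each of its elements.  The members that are lost have small
total proportion.  When the fragments have become short, one last round of
density about [q log l] makes most of them empty. *)

(** * Random subsets with independent elements *)

Section BernoulliSets.
Local Open Scope ring_scope.
Variables (R : realFieldType) (T : finType).
Implicit Types (p q a b : T -> R) (W Z A : {set T}).

(** Densities vary with the element so that elements outside a ground set can be
given density 0; this keeps all sums over the whole powerset. *)
Definition bern p W : R := \prod_e (if e \in W then p e else 1 - p e).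

Lemma bern_ge0 p W : (forall e, 0 <= p e <= 1) -> 0 <= bern p W.
Proof.
move=> p01; apply: prodr_ge0 => e _.
by have /andP[p0 p1] := p01 e; case: ifP; rewrite ?subr_ge0.
Qed.

Lemma sum_bern p : \sum_W bern p W = 1.
Proof.
rewrite /bern -(bigA_distr _ _ p (fun e => 1 - p e)) big1 // => e _.
by rewrite /= subrKC.
Qed.

(** The union of two independent random sets is again a random set; this is how
a random set gets exposed in rounds.  Once [Z] is fixed, the event
[W :|: W' = Z] factors over the elements. *)
Lemma bern_setU a b (f : {set T} -> R) :
  \sum_W \sum_Z bern a W * bern b Z * f (W :|: Z) =
  \sum_Z bern (fun e => a e + b e - a e * b e) Z * f Z.
Proof.
have E W Z : bern a W * bern b Z * f (W :|: Z) =
  \sum_(U : {set T}) (\prod_e ((if e \in W then a e else 1 - a e) *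
     (if e \in Z then b e *+ (e \in U)
      else (1 - b e) *+ ((e \in W) == (e \in U))))) * f U.
  rewrite (bigD1 (W :|: Z)) //= [X in _ + X]big1 ?addr0; last first.
    move=> U /eqP nU; have [e ne] : exists e, (e \in U) != (e \in W :|: Z).
      apply/existsP; rewrite -negb_forall; apply/negP => /forallP h; apply: nU.
      by apply/setP => e; apply/eqP.
    rewrite (bigD1 e) //=; move: ne; rewrite in_setU.
    by case: (e \in U); case: (e \in W); case: (e \in Z); rewrite //= ?mulr0 ?mul0r.
  congr (_ * _); rewrite -big_split /=; apply: eq_bigr => e _.
  by rewrite in_setU; case: (e \in W); case: (e \in Z); rewrite //= ?mulr1n.
under eq_bigr do under eq_bigr do rewrite E.
under eq_bigr do rewrite exchange_big /=.
rewrite exchange_big /=; apply: eq_bigr => U _.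
under eq_bigr do rewrite -mulr_suml.
rewrite -mulr_suml; congr (_ * _).
under eq_bigr => W _.
  under eq_bigr do rewrite big_split /=.
  rewrite -mulr_sumr -bigA_distr -big_split /=.
  rewrite (_ : \prod_i _ = \prod_e (if e \in W then a e *+ (e \in U)
     else (1 - a e) * (if e \in U then b e else 1 - b e))); last first.
    apply: eq_bigr => e _; case: (e \in W); case: (e \in U) => //=;
    by rewrite ?mulr0n ?mulr1n ?(addr0, add0r) ?subrKC ?(mulr0, mulr1).
  over.
have in_U (x y : R) : x + (1 - x) * y = x + y - x * y by ring.
have notin_U (x y : R) : 0 + (1 - x) * (1 - y) = 1 - (x + y - x * y) by ring.
rewrite -bigA_distr; apply: eq_bigr => e _.
by case: (e \in U); rewrite ?mulr1n ?mulr0n; [exact: in_U | exact: notin_U].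
Qed.

(** Putting [e] into the random set replaces a factor [1 - p e <= 1] of the weight
by [p e >= L * q e]. *)
Lemma bern_shift p q (L : R) W A : 0 < L ->
  (forall e, 0 <= q e) -> (forall e, L * q e <= p e) -> (forall e, p e <= 1) ->
  [disjoint A & W] ->
  bern p W * \prod_(e in A) q e <= L^-1 ^+ #|A| * bern p (W :|: A).
Proof.
move=> L0 q0 Lq p1 dAW.
rewrite -prodr_const (big_mkcond (mem A)) [X in _ <= X * _](big_mkcond (mem A)).
rewrite -!big_split /=; apply: ler_prod => e _.
have p0 : 0 <= p e by apply: le_trans (Lq e); rewrite mulr_ge0 // ltW.
rewrite in_setU orbC; case: (boolP (e \in A)) => eA; last first.
  rewrite /= mul1r mulr1 lexx andbT.
  by case: ifP; rewrite ?subr_ge0.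
rewrite (disjointFr dAW eA) mulr_ge0 ?subr_ge0 //= ler_pdivlMl //.
apply: le_trans (Lq e).
by rewrite mulrCA ler_piMl ?mulr_ge0 ?(ltW L0) // gerBl.
Qed.
End BernoulliSets.

(** * Minimum fragments *)

Section Fragments.
Local Open Scope ring_scope.
Variables (T I : finType).
Implicit Types (S : I -> {set T}) (J : {set I}) (W : {set T}).

Definition fragment S J W (i : I) : {set T} :=
  S [arg min_(j < i | (j \in J) && (S j \subset W :|: S i)) #|S j :\: W|] :\: W.

Lemma fragmentP S J W i : i \in J ->
  exists j, [/\ j \in J, S j \subset W :|: S i, fragment S J W i = S j :\: W &
    forall k, k \in J -> S k \subset W :|: S i ->
      (#|fragment S J W i| <= #|S k :\: W|)%N].
Proof.
move=> iJ; rewrite /fragment; case: arg_minnP => [|j /andP[jJ sj] jmin].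
  by rewrite iJ subsetUr.
by exists j; split=> // k kJ sk; apply: jmin; rewrite kJ.
Qed.

Lemma fragment_sub S J W i : i \in J -> fragment S J W i \subset S i.
Proof. by move=> /(fragmentP S W)[j [_ sj -> _]]; rewrite subDset. Qed.

Lemma fragment_disjoint S J W i : [disjoint fragment S J W i & W].
Proof. by rewrite -setI_eq0 setIDAC setDIl setDv setI0. Qed.

(** A member of the family inside [W :|: F], for a fragment [F], has a part
outside [W] that competes with [F] and lies in [F], so minimality makes it equal
to [F].  Hence one choice of member, depending on [W :|: F] only, confines [F]. *)
Lemma fragment_confined S J W i k : i \in J -> k \in J ->
  S k \subset W :|: fragment S J W i -> fragment S J W i \subset S k.
Proof.
move=> iJ kJ sk; have [j [_ sj Ej jmin]] := fragmentP S W iJ.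
have sF : S k :\: W \subset fragment S J W i by rewrite subDset.
have := jmin k kJ (subset_trans sk (setUS W (fragment_sub S W iJ))).
move=> le; have /eqP <- : S k :\: W == fragment S J W i by rewrite eqEcard sF.
exact: subsetDl.
Qed.
End Fragments.

(** [M] stands for the size of the family. It is kept when members of the family
get discarded, which makes the condition pass to subfamilies. *)
Definition spread (R : realFieldType) (T I : finType) (q : T -> R)
    (S : I -> {set T}) (J : {set I}) (M : R) : Prop :=
  forall A : {set T},
    (#|[set i in J | A \subset S i]|%:R <= M * \prod_(e in A) q e)%R.

Section OneRound.
Local Open Scope ring_scope.
Variables (R : realFieldType) (T I : finType).
Variables (S : I -> {set T}) (J : {set I}) (l k : nat).
Hypothesis Sl : forall i, i \in J -> (#|S i| <= l)%N.

Let large (W A : {set T}) : bool :=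
  (k < #|A|)%N && [exists i in J, fragment S J W i == A].

(** The pair [(W, F)] is recovered from [F] and [Z = W :|: F], as [F] is disjoint
from [W], and [F] is one of the [2 ^ l] subsets of a member chosen from [Z]. *)
Lemma card_large_fragments (Z : {set T}) :
  (#|[set x : {set T} * {set T} | large x.1 x.2 & x.1 :|: x.2 == Z]| <= 2 ^ l)%N.
Proof.
set D := [set _ | _].
have [->|[[W0 A0]]] := set_0Vmem D; first by rewrite cards0.
rewrite inE /= => /andP[/andP[_ /existsP[i0 /andP[i0J /eqP A0E]]] /eqP Z0].
have [j [jJ _ Ej _]] := fragmentP S W0 i0J.
have SjZ : S j \subset Z by rewrite -Z0 -A0E Ej -subDset.
have Dj x : x \in D -> x.2 \subset S j /\ x.1 = Z :\: x.2.
  rewrite inE => /andP[/andP[_ /existsP[i /andP[iJ /eqP xE]]] /eqP xZ].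
  rewrite -{1}xE -xZ; split.
    by apply: fragment_confined => //; rewrite xE xZ.
  have := fragment_disjoint S J x.1 i; rewrite xE disjoint_sym.
  by rewrite -setI_eq0 => /eqP d; rewrite setDUl setDv setU0 -[LHS](setID _ x.2) d set0U.
have inj : {in D &, injective (fun x => x.2)}.
  by move=> [W A] [W' A'] /Dj[_ /= ->] /Dj[_ /= ->] /= ->.
rewrite -(card_in_imset inj); apply: leq_trans (_ : (#|powerset (S j)| <= _)%N).
  apply: subset_leq_card; apply/subsetP => _ /imsetP[x /Dj[xS _] ->].
  by rewrite inE.
by rewrite card_powerset leq_exp2l ?Sl.
Qed.

(** Spread bounds the number of members with fragment [F] by
[M * \prod_(e in F) q e], and [bern_shift] trades this product for moving [F]
into the random set; the union [W :|: F] then has total weight 1, each value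
arising from at most [2 ^ l] pairs. *)
Lemma fragment_loss (p q : T -> R) (L M : R) :
  1 <= L -> (forall e, 0 <= q e) -> (forall e, L * q e <= p e) ->
  (forall e, p e <= 1) -> spread q S J M ->
  \sum_W bern p W * #|[set i in J | (k < #|fragment S J W i|)%N]|%:R
    <= M * (2 ^+ l / L ^+ k.+1).
Proof.
move=> L1 q0 Lq p1 sq.
have L0 : 0 < L by apply: lt_le_trans L1.
have p0 e : 0 <= p e by apply: le_trans (Lq e); rewrite mulr_ge0 // ltW.
have p01 e : 0 <= p e <= 1 by rewrite p0 p1.
have M0 : 0 <= M.
  have := sq set0; rewrite big_set0 mulr1; apply: le_trans.
  exact: ler0n.
apply: (@le_trans _ _ (\sum_W \sum_(A | large W A) M * L^-1 ^+ k.+1 * bern p (W :|: A))).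
  apply: ler_sum => W _; set D := [set _ | _].
  have -> : #|D|%:R = \sum_(A | large W A) #|[set i in D | fragment S J W i == A]|%:R :> R.
    rewrite -natr_sum -sum1_card (partition_big (fragment S J W) (large W)) /=.
      by congr (_%:R); apply: eq_bigr => A _; rewrite -sum1_card; apply: eq_bigl => i; rewrite !inE.
    move=> i; rewrite inE => /andP[iJ ki]; rewrite /large ki /=.
    by apply/existsP; exists i; rewrite iJ eqxx.
  rewrite mulr_sumr; apply: ler_sum => A /andP[kA /existsP[i /andP[iJ /eqP iA]]].
  apply: (@le_trans _ _ (bern p W * (M * \prod_(e in A) q e))).
    apply: ler_wpM2l; first exact: bern_ge0.
    apply: le_trans (sq A); rewrite ler_nat; apply: subset_leq_card.
    apply/subsetP => j; rewrite !inE => /andP[/andP[jJ _] /eqP <-].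
    by rewrite jJ fragment_sub.
  rewrite mulrCA -mulrA; apply: ler_wpM2l => //.
  have := bern_shift L0 q0 Lq p1 (A := A) (W := W).
  rewrite -{1}iA fragment_disjoint => /(_ isT) le; apply: le_trans le _.
  apply: ler_wpM2r; first exact: bern_ge0.
  apply: ler_wiXn2l => //; first by rewrite invr_ge0 ltW.
  by rewrite invf_le1.
rewrite pair_big_dep /=.
rewrite (partition_big (fun x => x.1 :|: x.2) xpredT) //=.
rewrite [leRHS](_ : _ = \sum_(Z : {set T}) M * (2 ^+ l / L ^+ k.+1) * bern p Z); last first.
  by rewrite -mulr_sumr sum_bern mulr1.
apply: ler_sum => Z _.
rewrite (eq_bigr (fun=> M * L^-1 ^+ k.+1 * bern p Z)); last first.
  by move=> x /andP[_ /eqP ->].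
rewrite big_const iter_addr addr0 -[leLHS]mulr_natl exprVn.
rewrite [leRHS](_ : _ = 2 ^+ l * (M / L ^+ k.+1 * bern p Z)); last first.
  by rewrite [M * (_ / _)]mulrCA !mulrA.
apply: ler_wpM2r.
  by rewrite mulr_ge0 ?bern_ge0 // mulr_ge0 // invr_ge0 exprn_ge0 // ltW.
rewrite -natrX ler_nat; apply: leq_trans (card_large_fragments Z).
by rewrite cardsE.
Qed.
End OneRound.

(** * The spread lemma *)

Section SpreadLemma.
Local Open Scope ring_scope.
Variables (R : realFieldType) (T I : finType) (q : T -> R).
Hypothesis q0 : forall e, 0 <= q e.
Implicit Types (S : I -> {set T}) (J : {set I}).

Definition misses S J (W : {set T}) : bool :=
  [forall i in J, ~~ (S i \subset W)].

Definition miss_prob (p : T -> R) S J : R := \sum_(W | misses S J W) bern p W.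

(** If the random set contains no member, then all fragments are nonempty. *)
Lemma miss_one_round S J (M L : R) (p : T -> R) s :
  1 <= L -> (forall e, L * q e <= p e) -> (forall e, p e <= 1) ->
  spread q S J M -> (forall i, i \in J -> (#|S i| <= s)%N) ->
  miss_prob p S J * #|J|%:R <= M * (2 ^+ s / L).
Proof.
move=> L1 Lq p1 sq Sl.
have p01 e : 0 <= p e <= 1.
  by rewrite p1 andbT (le_trans _ (Lq e)) // mulr_ge0 // (le_trans ler01).
have := fragment_loss 0 Sl L1 q0 Lq p1 sq.
rewrite expr1; apply: le_trans.
rewrite mulr_suml big_mkcond /=; apply: ler_sum => W _.
case: ifP => [/forallP mW|_]; last by rewrite mulr_ge0 ?bern_ge0.
rewrite ler_wpM2l ?bern_ge0 // ler_nat; apply: subset_leq_card.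
apply/subsetP => i iJ; rewrite inE iJ card_gt0 /=.
have [j [jJ _ -> _]] := fragmentP S W iJ.
by rewrite -subset0 subDset setU0; have := mW j; rewrite jJ.
Qed.

(** If the union of two random sets contains no member, the second one contains
no fragment relative to the first.  Members with long fragments are given up,
at the price of their number. *)
Lemma miss_split (a b : T -> R) S J k (c : R) :
  (forall e, 0 <= a e <= 1) -> (forall e, 0 <= b e <= 1) ->
  (forall W, miss_prob b (fragment S J W)
     [set i in J | (#|fragment S J W i| <= k)%N] *
     #|[set i in J | (#|fragment S J W i| <= k)%N]|%:R <= c) ->
  miss_prob (fun e => a e + b e - a e * b e) S J * #|J|%:R <=
  c + \sum_W bern a W * #|[set i in J | (k < #|fragment S J W i|)%N]|%:R.
Proof.
move=> a01 b01 hc.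
have -> : c = \sum_W bern a W * c by rewrite -mulr_suml sum_bern mul1r.
have -> : miss_prob (fun e => a e + b e - a e * b e) S J =
  \sum_W bern (fun e => a e + b e - a e * b e) W * (if misses S J W then 1 else 0).
  by rewrite /miss_prob big_mkcond; apply: eq_bigr => W _; case: ifP; rewrite ?mulr1 ?mulr0.
rewrite -(bern_setU a b (fun W => if misses S J W then 1 else 0)).
rewrite mulr_suml -big_split /=; apply: ler_sum => W _.
have := hc W; set J1 := [set i in J | (_ <= k)%N] => hcW.
set J2 := [set i in J | (k < _)%N].
rewrite -mulrDr; under eq_bigr do rewrite -mulrA.
rewrite -mulr_sumr -mulrA; apply: ler_wpM2l; first exact: bern_ge0.
apply: le_trans (lerD hcW (lexx _)).
have JE : (#|J| = #|J1| + #|J2|)%N.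
  rewrite -(cardsID J1 J); congr (_ + _)%N; apply: eq_card => i; rewrite !inE.
    by rewrite andbA andbb.
  by rewrite negb_and -ltnNge; case: (i \in J); rewrite ?andbF ?andbT.
rewrite JE natrD mulrDr; apply: lerD; last first.
  apply: ler_piMl => //; rewrite -[leRHS](sum_bern b); apply: ler_sum => Z _.
  by case: ifP => _; rewrite ?mulr1 ?mulr0 // bern_ge0.
apply: ler_wpM2r => //; rewrite [leRHS]/miss_prob [leRHS]big_mkcond /=.
apply: ler_sum => Z _; case: ifP => [/forallP mWZ|_]; last first.
  by rewrite mulr0; case: ifP; rewrite ?bern_ge0.
rewrite mulr1 ifT //; apply/forallP => i; apply/implyP.
rewrite inE => /andP[iJ _]; have [j [jJ _ -> _]] := fragmentP S W iJ.
by rewrite subDset; have := mWZ j; rewrite jJ.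
Qed.

(** Each of the [k] rounds of density [64 q] halves the size bound.  The round
from [2 * h] to [h] gives up a proportion of at most
[2 ^ (2 * h) / 64 ^ h.+1 <= 4 ^- s] of the members, as [h >= s].  The last round
has density [L * q]. *)
Lemma miss_rounds (L : R) s k : 1 <= L ->
  forall S J (M : R) (p : T -> R),
  (forall e, (64 * k%:R + L) * q e <= p e) -> (forall e, p e <= 1) ->
  spread q S J M -> (forall i, i \in J -> (#|S i| <= 2 ^ k * s)%N) ->
  miss_prob p S J * #|J|%:R <= M * (2 ^+ s / L + k%:R / 4 ^+ s).
Proof.
move=> L1; elim: k => [|k IH] S J M p Lq p1 sq Sl.
  rewrite mul0r addr0; apply: miss_one_round => //.
    by move=> e; have := Lq e; rewrite mulr0 add0r.
  by move=> i /Sl; rewrite mul1n.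
have L0 : 0 <= L by apply: le_trans L1.
have M0 : 0 <= M.
  by have := sq set0; rewrite big_set0 mulr1; apply: le_trans; exact: ler0n.
pose a e := 64 * q e.
(* [b] solves [a + b - a * b = p]; where [a e = 1], every [b e] does *)
pose b e := if a e == 1 then 1 else (p e - a e) / (1 - a e).
have a0 e : 0 <= a e by rewrite mulr_ge0.
have qab e : (64 * k%:R + L) * q e <= p e - a e.
  by rewrite lerBrDr; apply: le_trans (Lq e); rewrite /a -natr1; lra.
have q'0 e : 0 <= (64 * k%:R + L) * q e.
  by rewrite mulr_ge0 // addr_ge0 // mulr_ge0.
have ap e : a e <= p e by rewrite -subr_ge0 (le_trans (q'0 e)).
have a1 e : a e <= 1 by apply: le_trans (p1 e).
have b1 e : b e <= 1.
  rewrite /b; case: eqVneq => // ne; rewrite ler_pdivrMr ?mul1r ?lerD2r //.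
  by rewrite subr_gt0 lt_neqAle ne a1.
have qb e : (64 * k%:R + L) * q e <= b e.
  rewrite /b; case: eqVneq => [ae|ne].
    by apply: le_trans (qab e) _; rewrite ae; have := p1 e; lra.
  have lt1 : a e < 1 by rewrite lt_neqAle ne a1.
  rewrite ler_pdivlMr ?subr_gt0 //; apply: le_trans (qab e).
  by rewrite ler_piMr // gerBl.
have pE : p =1 (fun e => a e + b e - a e * b e).
  move=> e; rewrite /b; case: eqVneq => [ae|ne].
    by apply/eqP; rewrite ae mul1r addrK eq_le p1 -ae ap.
  field; by rewrite subr_eq0 eq_sym.
have -> : miss_prob p S J = miss_prob (fun e => a e + b e - a e * b e) S J.
  by apply: eq_bigr => W _; apply: eq_bigr => e _; rewrite pE.
have a01 e : 0 <= a e <= 1 by rewrite a0 a1.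
have b01 e : 0 <= b e <= 1 by rewrite b1 (le_trans _ (qb e)).
apply: le_trans (miss_split (k := 2 ^ k * s)
  (c := M * (2 ^+ s / L + k%:R / 4 ^+ s)) a01 b01 _) _.
  move=> W; apply: IH => //.
    move=> A; apply: le_trans (sq A); rewrite ler_nat; apply: subset_leq_card.
    apply/subsetP => i; rewrite !inE => /andP[/andP[iJ _] Ai]; rewrite iJ /=.
    exact: subset_trans Ai (fragment_sub _ _ iJ).
  by move=> i; rewrite inE => /andP[].
rewrite -[k.+1%:R]natr1 mulrDl addrA [leRHS]mulrDr lerD2l.
have L64 : 1 <= 64 :> R by rewrite ler1n.
apply: le_trans (fragment_loss (2 ^ k * s) Sl L64 q0 (fun=> lexx _) a1 sq) _.
apply: ler_wpM2l => //.
have : (s <= 2 ^ k * s)%N by rewrite leq_pmull // expn_gt0.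
rewrite mul1r expnS -mulnA; move: (2 ^ k * s)%N => h sh.
rewrite ler_pdivrMr ?exprn_gt0 // ler_pdivlMl ?exprn_gt0 // -!natrX -natrM ler_nat.
rewrite (_ : 64 = 4 ^ 3)%N // expnM (_ : 2 ^ 2 = 4)%N // -expnM -expnD leq_exp2l //.
by rewrite mulnS !mulSn mul0n !addn0; apply: leq_trans (leq_addl _ _); rewrite leq_add ?leq_addr.
Qed.

(** The choice [s = 2 * u] and [k = L = 8 ^ u] in [miss_rounds] balances the two
losses [2 ^ s / L] and [k / 4 ^ s], which both become [2 ^- u]. *)
Theorem spread_lemma u S J (M : R) (p : T -> R) :
  (forall e, (65 * 8 ^+ u) * q e <= p e) -> (forall e, p e <= 1) ->
  spread q S J M -> (forall i, i \in J -> (#|S i| <= 2 ^ 8 ^ u)%N) ->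
  (0 < u)%N ->
  miss_prob p S J * #|J|%:R <= M * (2 / 2 ^+ u).
Proof.
move=> Lq p1 sq Sl u0.
have M0 : 0 <= M.
  by have := sq set0; rewrite big_set0 mulr1; apply: le_trans; exact: ler0n.
have : 1 <= 8 ^+ u :> R by rewrite exprn_ege1 // ler1n.
move=> /miss_rounds -/(_ (2 * u)%N (8 ^ u)%N S J M p) h.
apply: le_trans (h _ p1 sq _) _.
- by move=> e; apply: le_trans (Lq e); rewrite natrX; lra.
- by move=> i /Sl le; apply: leq_trans le (leq_pmulr _ _); rewrite muln_gt0.
apply: ler_wpM2l => //.
have u2 : 2 ^+ u != 0 :> R by rewrite expf_neq0 // pnatr_eq0.
have pow2 a b : (a = 2 ^ b)%N -> a%:R ^+ u = (2 ^+ u) ^+ b :> R.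
  by move=> ->; rewrite natrX -!exprM mulnC.
rewrite natrX exprM mulnC exprM (pow2 8 3) // (pow2 4 2) // -exprM mulnC exprM.
move: (2 ^+ u) u2 => x x0.
by rewrite le_eqVlt; apply/orP; left; apply/eqP; field.
Qed.
End SpreadLemma.

(** * Reversing an interval *)

Section Reflection.
Variable m : nat.

(** Values pushed out of ['I_m] are left in place, so that this is an involution
for all [a] and [b]. *)
Definition reflect_fun (a b : nat) (k : 'I_m) : 'I_m :=
  insubd k (if a <= k <= b then a + b - k else k).

Lemma reflect_funE a b (k : 'I_m) : reflect_fun a b k =
  (if (if a <= k <= b then a + b - k else k) < m
   then if a <= k <= b then a + b - k else k else k) :> nat.
Proof. exact: val_insubd. Qed.

Lemma reflect_funK a b : involutive (reflect_fun a b).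
Proof.
move=> k; apply: ord_inj; rewrite !reflect_funE.
move: (nat_of_ord k) (ltn_ord k) => {}k km.
have [h|/negbTE h] := boolP (a <= k <= b); last by rewrite km h km.
have [h'|/negbTE h'] := boolP (a + b - k < m); last by rewrite h h'.
have -> : a <= a + b - k <= b by lia.
have -> : a + b - (a + b - k) = k by lia.
by rewrite km.
Qed.

Definition reflection a b : {perm 'I_m} := perm (inv_inj (@reflect_funK a b)).

Lemma reflectionE a b (k : 'I_m) : b < m ->
  reflection a b k = (if a <= k <= b then a + b - k else k) :> nat.
Proof.
move=> bm; rewrite permE reflect_funE.
move: (nat_of_ord k) (ltn_ord k) => {}k km.
have [h|/negbTE h] := boolP (a <= k <= b); last by rewrite km.
have -> // : a + b - k < m by lia.
Qed.

Lemma reflectionK a b : involutive (reflection a b).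
Proof. by move=> k; rewrite !permE reflect_funK. Qed.

Lemma val_ordS (i : 'I_m) : ordS i = (if i.+1 == m then 0 else i.+1) :> nat.
Proof.
rewrite /=; case: eqP => [->|ne]; first by rewrite modnn.
by rewrite modn_small // ltn_neqAle ltn_ord andbT; apply/eqP.
Qed.
End Reflection.

(** * Switching in loose cycles *)

Section LooseCycles.
Variables (m : nat) (V : finType) (x y : 'I_m -> V).
Hypotheses (x_inj : injective x) (y_inj : injective y).
Hypothesis xy : forall i j, x i != y j.
Local Notation order := ({perm 'I_m} * {perm 'I_m})%type.
Implicit Types (w : order) (i j k : 'I_m) (A : {set {set V}}).

Definition loose_edge w i : {set V} := [set x (w.1 i); y (w.2 i); x (w.1 (ordS i))].
Definition loose_cycle w : {set {set V}} := [set loose_edge w i | i : 'I_m].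

Lemma loose_edge_eq w w' i j : loose_edge w i = loose_edge w' j ->
  w.2 i = w'.2 j /\ [set w.1 i; w.1 (ordS i)] = [set w'.1 j; w'.1 (ordS j)].
Proof.
move=> E; split.
  have : y (w.2 i) \in loose_edge w' j by rewrite -E !inE eqxx orbT.
  by rewrite !inE ![y _ == x _]eq_sym !(negbTE (xy _ _)) orbF /= => /eqP/y_inj.
have xE u v k : (x v \in loose_edge u k) = (v \in [set u.1 k; u.1 (ordS k)]).
  by rewrite !inE (negbTE (xy _ _)) orbF !(inj_eq x_inj).
by apply/setP => v; rewrite -!xE E.
Qed.

Lemma loose_edge_inj w : injective (loose_edge w).
Proof. by move=> i j /loose_edge_eq[/perm_inj]. Qed.

(** Cut the edges at positions [i] and [j] and reverse the arc between them.  An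
arc of [l] vertices carries [l - 1] uncut edges, hence the two different
reflections of vertex positions and edge positions. *)
Definition two_opt w i j : order :=
  (reflection m (minn i j).+1 (maxn i j) * w.1,
   reflection m (minn i j).+1 (maxn i j).-1 * w.2)%g.

Definition swap_mid w i k : order := (w.1, tperm i k * w.2)%g.

(** The reversed arc is traversed backwards: inside it, the new edge at [k] is the
old edge at the reflected position with its ends exchanged. *)
Lemma two_opt_edge w i j k : i != j -> k != i -> k != j ->
  loose_edge (two_opt w i j) k =
  loose_edge w (reflection m (minn i j).+1 (maxn i j).-1 k).
Proof.
move=> /eqP ij /eqP ki /eqP kj; rewrite /loose_edge /= !permM.
set r := reflection m _ (maxn i j); set r' := reflection m _ (maxn i j).-1.
have [[Hi Hj] Hk] := (ltn_ord i, ltn_ord j, ltn_ord k).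
have Eij : i <> j :> nat by move=> e; apply: ij; apply: ord_inj.
have Eik : k <> i :> nat by move=> e; apply: ki; apply: ord_inj.
have Ejk : k <> j :> nat by move=> e; apply: kj; apply: ord_inj.
have mx : maxn i j < m by lia.
have mx' : (maxn i j).-1 < m by lia.
have rE l : r l = (if minn i j < l <= maxn i j then (minn i j).+1 + maxn i j - l else l) :> nat.
  exact: reflectionE.
have r'E l : r' l = (if minn i j < l <= (maxn i j).-1 then (minn i j).+1 + (maxn i j).-1 - l else l) :> nat.
  exact: reflectionE.
case: (boolP (minn i j < k <= (maxn i j).-1)) => kin.
  have -> : r k = ordS (r' k).
    by apply: ord_inj; rewrite rE val_ordS r'E kin; do ?case: ifP => ?; lia.
  have -> : r (ordS k) = r' k.
    have Sk : ordS k = k.+1 :> nat by rewrite val_ordS; case: ifP; lia.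
    by apply: ord_inj; rewrite rE r'E kin Sk; case: ifP; lia.
  by rewrite setUC [X in _ :|: X]setUC setUA.
have -> : r k = k by apply: ord_inj; rewrite rE; case: ifP => ?; lia.
have -> : r' k = k by apply: ord_inj; rewrite r'E (negbTE kin).
have -> // : r (ordS k) = ordS k.
apply: ord_inj; rewrite rE (_ : _ <= _ <= _ = false) //.
by have := val_ordS k; case: ifP => ? ->; lia.
Qed.

Lemma two_opt_edgeV w i j k : i != j -> k != i -> k != j ->
  loose_edge w k \in loose_cycle (two_opt w i j).
Proof.
move=> ij ki kj; set r := reflection m (minn i j).+1 (maxn i j).-1.
apply/imsetP; exists (r k) => //.
have Eij : i <> j :> nat by move=> /val_inj e; rewrite e eqxx in ij.
have Eik : k <> i :> nat by move=> /val_inj e; rewrite e eqxx in ki.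
have Ejk : k <> j :> nat by move=> /val_inj e; rewrite e eqxx in kj.
have [[Hi Hj] Hk] := (ltn_ord i, ltn_ord j, ltn_ord k).
have rE : r k = (if minn i j < k <= (maxn i j).-1 then (minn i j).+1 + (maxn i j).-1 - k else k) :> nat.
  by apply: reflectionE; lia.
rewrite two_opt_edge ?reflectionK //; apply/eqP => /(congr1 val) /=; rewrite rE;
  case: ifP => ?; lia.
Qed.

Definition switch w i j k := two_opt (swap_mid w i k) i j.

Lemma switch_sub A w i j k : A \subset loose_cycle w -> i != j ->
  loose_edge w i \notin A -> loose_edge w j \notin A -> loose_edge w k \notin A ->
  A \subset loose_cycle (switch w i j k).
Proof.
move=> Aw ij iA jA kA; apply/subsetP => e eA.
have /imsetP[n _ eE] := subsetP Aw _ eA; rewrite eE in eA *.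
have [ni nj nk] : [/\ n != i, n != j & n != k].
  by split; apply: contraTneq eA => ->.
have -> : loose_edge w n = loose_edge (swap_mid w i k) n.
  by rewrite /loose_edge /= permM tpermD // eq_sym.
exact: two_opt_edgeV.
Qed.

(** Where the ends of the cut edge went: this locates the positions [i] and [j]
of a switching from its result. *)
Lemma switch_ends w i j k : i != j ->
  [set w.1 i; w.1 (ordS i)] = [set (switch w i j k).1 l | l in
     if i < j then [set i; j] else [set ordS i; ordS j]].
Proof.
move=> ij.
have Eij : i <> j :> nat by move=> /val_inj e; rewrite e eqxx in ij.
have [Hi Hj] := (ltn_ord i, ltn_ord j).
rewrite fun_if.
set r := reflection m (minn i j).+1 (maxn i j).
have rE l : r l = (if minn i j < l <= maxn i j then (minn i j).+1 + maxn i j - l else l) :> nat.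
  by apply: reflectionE; lia.
have Ei := val_ordS i; have Ej := val_ordS j.
case: ifP => ij'; rewrite imsetU !imset_set1 /= !permM -/r.
  have -> : r i = i by apply: ord_inj; rewrite rE; case: ifP => ?; lia.
  have -> // : r j = ordS i.
  by apply: ord_inj; rewrite rE Ei; do ?case: ifP => ?; lia.
have -> : r (ordS j) = i.
  have {}Ej : ordS j = j.+1 :> nat by rewrite Ej; case: ifP; lia.
  by apply: ord_inj; rewrite rE Ej; case: ifP => ?; lia.
have -> : r (ordS i) = ordS i; last by rewrite setUC.
apply: ord_inj; rewrite rE (_ : _ <= _ <= _ = false) //.
by move: Ei; case: ifP => ? ->; lia.
Qed.

(** The ends of the edge [loose_edge w i] give the unordered pair [i], [j], the
bit [i < j] orders it, and the place of the middle vertex of that edge gives [k]. *)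
Lemma switch_inj w w' i i' j j' k k' :
  i != j -> i' != j' -> loose_edge w i = loose_edge w' i' ->
  (i < j) = (i' < j') -> switch w i j k = switch w' i' j' k' ->
  [/\ w = w', i = i', j = j' & k = k'].
Proof.
move=> ij ij' /loose_edge_eq[mid ends] b E.
have : (if i < j then [set i; j] else [set ordS i; ordS j]) =
       (if i < j then [set i'; j'] else [set ordS i'; ordS j']).
  apply: (imset_inj (@perm_inj _ (switch w i j k).1)).
  by rewrite -(switch_ends w k ij) E b -(switch_ends w' k' ij').
have ordS_inj : injective (@ordS m) := can_inj (@ordSK m).
have ijE : [set i; j] = [set i'; j'] -> i = i' /\ j = j'.
  have Eij : i <> j :> nat by move=> /ord_inj e; rewrite e eqxx in ij.
  have Eij' : i' <> j' :> nat by move=> /ord_inj e; rewrite e eqxx in ij'.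
  move=> S; have : i \in [set i'; j'] by rewrite -S set21.
  have : j \in [set i'; j'] by rewrite -S set22.
  rewrite !inE => /orP[]/eqP ej /orP[]/eqP ei; subst i j; split=> //; move: b; lia.
have SS l n : [set ordS l; ordS n] = [set ordS u | u in [set l; n]].
  by rewrite imsetU !imset_set1.
move=> ifE; have [ei ej] : i = i' /\ j = j'.
  by apply: ijE; move: ifE; case: ifP => // _; rewrite !SS; apply: imset_inj.
subst i' j'; case: E => /mulgI e1 /mulgI e2.
have ek : k = k'.
  have : (tperm i k * w.2)%g k = (tperm i k' * w'.2)%g k' by rewrite !permM !tpermR.
  by rewrite e2 => /perm_inj.
by subst k'; split=> //; case: w w' e1 e2 {ends mid ifE} => ? ? [? ?] /= -> /mulgI ->.
Qed.

Definition containing A := [set w | A \subset loose_cycle w].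

(** There are at least [m.-1 - #|A|] positions [j], and as many [k], whose edges
avoid both [A] and [e].  The factor 2 is the bit needed in [switch_inj]. *)
Lemma card_containing_setU1 A e : e \notin A ->
  #|containing (e |: A)| * (m.-1 - #|A|) ^ 2 <= #|containing A| * 2.
Proof.
move=> eA; set d := m.-1 - #|A|.
pose F (u : order * 'I_m) :=
  [set j | (u.2 != j) && (loose_edge u.1 j \notin A)].
pose U := [set u : order * 'I_m |
  (u.1 \in containing A) && (loose_edge u.1 u.2 == e)].
(* a switching [((w, i), (j, k))]: [i] is the position of [e] in [w] *)
pose D := [set t : (order * 'I_m) * ('I_m * 'I_m) |
  (t.1 \in U) && (t.2 \in setX (F t.1) (F t.1))].
have cardF u : d <= #|F u|.
  rewrite /d leq_subLR.
  have : #|[set j | loose_edge u.1 j \in A]| <= #|A|.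
    rewrite -(card_imset _ (@loose_edge_inj u.1)); apply: subset_leq_card.
    by apply/subsetP => _ /imsetP[j jA ->]; rewrite inE in jA.
  move=> le; apply: leq_trans (leq_add le (leqnn _)).
  have -> : m.-1 = #|[set~ u.2]| by rewrite cardsC1 card_ord.
  rewrite -cardsUI; apply: leq_trans (leq_addr _ _); apply: subset_leq_card.
  apply/subsetP => j; rewrite !inE eq_sym => ->.
  by case: (_ \in A).
have leU : #|containing (e |: A)| <= #|U|.
  apply: leq_trans (leq_imset_card fst _); apply: subset_leq_card.
  apply/subsetP => w; rewrite inE subUset sub1set => /andP[/imsetP[i _ eE] Aw].
  by apply/imsetP; exists (w, i) => //; rewrite !inE /= Aw -eE eqxx.
apply: (@leq_trans #|D|).
  apply: leq_trans (leq_mul leU (leqnn _)) _.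
  rewrite -sum_nat_const -[leqRHS]sum1_card.
  rewrite (eq_bigl (fun t => (t.1 \in U) && (t.2 \in setX (F t.1) (F t.1)))); last first.
    by move=> t; rewrite inE.
  rewrite -(pair_big_dep (mem U) (fun u v => v \in setX (F u) (F u)) (fun _ _ => 1)) /=.
  by apply: leq_sum => u _; rewrite sum1_card cardsX expnS expn1 leq_mul.
pose f (t : (order * 'I_m) * ('I_m * 'I_m)) :=
  (switch t.1.1 t.1.2 t.2.1 t.2.2, t.1.2 < t.2.1).
have f_inj : {in D &, injective f}.
  move=> [[w i] [j k]] [[w' i'] [j' k']]; rewrite !inE /=.
  move=> /andP[/andP[_ /eqP we] /andP[/andP[ij _] _]].
  move=> /andP[/andP[_ /eqP we'] /andP[/andP[ij' _] _]] E.
  have [E1 E2] := conj (congr1 fst E) (congr1 snd E).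
  have [|-> -> -> -> //] := @switch_inj w w' i i' j j' k k' ij ij' _ E2 E1.
  by rewrite we we'.
rewrite -(card_in_imset f_inj) -[2]card_bool -cardsT -cardsX; apply: subset_leq_card.
apply/subsetP => _ /imsetP[[[w i] [j k]] tD ->].
move: tD; rewrite !inE /= => /andP[/andP[Aw /eqP we] /andP[/andP[ij jA] /andP[ik kA]]].
by rewrite andbT switch_sub // we.
Qed.

(** A product of the bounds of [card_containing_setU1], where [m.-1 - b] is
replaced by [(m - b) / 2].  For [m - b = 1] that lemma says nothing, and
monotonicity of [containing] is used instead. *)
Lemma card_containing A :
  #|containing A| * (m ^_ #|A|) ^ 2 <= 8 ^ #|A| * m`! ^ 2.
Proof.
elim: {A}#|A| {1 3}A (erefl #|A|) => [|b IH] A.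
  move=> _; rewrite ffactn0 muln1 mul1n; apply: leq_trans (max_card _) _.
  by rewrite card_prod !card_Sn -mulnn.
move=> cA; have [e eA] : exists e, e \in A by apply/card_gt0P; rewrite cA.
have cB : #|A :\ e| = b by have := cardsD1 e A; rewrite eA cA; case.
have step : #|containing A| * (m - b) ^ 2 <= 8 * #|containing (A :\ e)|.
  have [le1|gt1] := leqP (m - b) 1.
    have sub : #|containing A| <= #|containing (A :\ e)|.
      apply: subset_leq_card; apply/subsetP => w; rewrite !inE.
      exact/subset_trans/subD1set.
    apply: (@leq_trans (#|containing (A :\ e)| * 1)); last by lia.
    by rewrite leq_mul // -[1](exp1n 2) leq_exp2r.
  have := @card_containing_setU1 (A :\ e) e; rewrite setD1K // cB setD11 => /(_ isT).
  have : (m - b) ^ 2 <= 4 * (m.-1 - b) ^ 2.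
    by rewrite (_ : 4 = 2 ^ 2) // -expnMn leq_exp2r //; lia.
  move=> /(leq_mul (leqnn #|containing A|)); lia.
rewrite ffactnSr expnMn mulnCA [8 ^ _]expnS -mulnA.
apply: leq_trans (leq_mul (leqnn _) step) _.
by rewrite mulnCA leq_pmul2l // mulnC IH.
Qed.
End LooseCycles.

(** * Loose Hamilton cycles are spread *)

Section LooseSpread.
Local Open Scope ring_scope.
Variable R : realType.

(** The induction step compares [m.+1 ^+ a] with [m%:R ^+ a]; their ratio is at
most [expR (a / m)]. *)
Lemma expr_le_ffact (m a : nat) : (a <= m)%N ->
  m%:R ^+ a <= expR 1 ^+ a * (m ^_ a)%:R :> R.
Proof.
elim: a m => [|a IH] m; first by rewrite !expr0 mul1r ffactn0.
case: m => // m; rewrite ltnS => am.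
rewrite ffactnS natrM !exprS [leRHS]mulrCA ler_wpM2l //=.
apply: (@le_trans _ _ (m%:R ^+ a * expR 1)); last first.
  by rewrite mulrC -mulrA ler_wpM2l ?expR_ge0 ?IH.
have [->|a0] := posnP a; first by rewrite !expr0 mul1r -expR0 ler_expR.
have m0 : 0 < m%:R :> R by rewrite ltr0n; lia.
have -> : m.+1%:R = m%:R * (1 + m%:R^-1) :> R.
  by rewrite mulrDr mulr1 divff ?lt0r_neq0 // natr1.
rewrite exprMn ler_wpM2l ?exprn_ge0 //.
apply: (@le_trans _ _ (expR m%:R^-1 ^+ a)).
  by rewrite lerXn2r ?nnegrE ?expR_ge0 ?addr_ge0 ?invr_ge0 // expR_ge1Dx.
rewrite -expRM_natl ler_expR.
by rewrite ler_pdivrMr // mul1r ler_nat.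
Qed.

Variables (V : finType).
Let m := #|V|./2.

Definition edge_density (c : R) : {set V} -> R :=
  fun e => if e \in triples V then c / m%:R ^+ 2 else 0.

Lemma loose_cycle_triples (x y : 'I_m -> V) w :
  injective x -> injective y -> (forall i j, x i != y j) -> (1 < m)%N ->
  loose_cycle x y w \subset triples V.
Proof.
move=> xI yI xy m1; apply/subsetP => _ /imsetP[i _ ->].
rewrite inE /loose_edge -setUA cardsU1 cards2 !inE (inj_eq xI) (inj_eq perm_inj).
rewrite (negbTE (xy _ _)) [y _ == _]eq_sym xy (_ : i != ordS i) //.
by apply/eqP => /(congr1 (@nat_of_ord _)); rewrite val_ordS; case: ifP; lia.
Qed.

Lemma loose_cycle_spread (x y : 'I_m -> V) :
  injective x -> injective y -> (forall i j, x i != y j) -> (1 < m)%N ->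
  spread (edge_density (8 * expR 1 ^+ 2)) (loose_cycle x y) [set: _] (m`!%:R ^+ 2).
Proof.
move=> xI yI xy m1 A.
have -> : [set w in [set: _] | A \subset loose_cycle x y w] = containing x y A.
  by apply/setP => w; rewrite !inE.
have [->|[w]] := set_0Vmem (containing x y A).
  rewrite cards0; apply: mulr_ge0; first by rewrite exprn_ge0.
  by apply: prodr_ge0 => e _; rewrite /edge_density; case: ifP.
rewrite inE => Aw.
have Am : (#|A| <= m)%N.
  apply: leq_trans (subset_leq_card Aw) _; apply: leq_trans (leq_imset_card _ _) _.
  by rewrite card_ord.
have At : A \subset triples V.
  by apply: subset_trans Aw (loose_cycle_triples w xI yI xy m1).
rewrite (eq_bigr (fun=> 8 * expR 1 ^+ 2 / m%:R ^+ 2)); last first.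
  by move=> e eA; rewrite /edge_density (subsetP At).
rewrite prodr_const.
have fp : 0 < (m ^_ #|A|)%:R ^+ 2 :> R by rewrite exprn_gt0 // ltr0n ffact_gt0.
have mp : 0 < m%:R ^+ #|A| :> R by rewrite exprn_gt0 // ltr0n ltnW.
rewrite -(ler_pM2r fp); have := card_containing xI yI xy A.
rewrite -(ler_nat R) !natrM !natrX => le; apply: le_trans le _.
rewrite mulrC -[leRHS]mulrA ler_wpM2l ?exprn_ge0 //.
have -> : (8 * expR 1 ^+ 2 / m%:R ^+ 2) ^+ #|A| * (m ^_ #|A|)%:R ^+ 2 =
  8 ^+ #|A| * ((expR 1 ^+ #|A| * (m ^_ #|A|)%:R) ^+ 2 / (m%:R ^+ #|A|) ^+ 2) :> R.
  rewrite !exprMn exprVn ![(_ ^+ 2) ^+ #|A|]exprAC.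
  move: (8 ^+ _) (expR 1 ^+ _) ((m ^_ _)%:R) (_ ^-1) => a b c d; ring.
apply: ler_peMr; first by rewrite exprn_ge0.
rewrite ler_pdivlMr; last by rewrite exprn_gt0.
rewrite mul1r lerXn2r ?nnegrE ?mulr_ge0 ?exprn_ge0 ?expR_ge0 //.
exact: expr_le_ffact.
Qed.
End LooseSpread.

(** * The random hypergraph *)

Section Probability.
Local Open Scope ring_scope.
Variable R : realType.

Definition triple_prob (n : nat) (p : R) : {set 'I_n} -> R :=
  fun e => if e \in triples 'I_n then p else 0.

Lemma Pr_H3_bern n (p : R) (Q : pred {set {set 'I_n}}) :
  Pr_H3 p Q = \sum_(E | Q E) bern (triple_prob p) E.
Proof.
rewrite /Pr_H3 [RHS](bigID (@uniform3 'I_n)) /= [X in _ = _ + X]big1 ?addr0; last first.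
  move=> E /andP[_ /subsetPn[e eE eT]].
  by rewrite /bern (bigD1 e) //= eE /triple_prob (negbTE eT) mul0r.
apply: eq_big => [E|E /andP[/subsetP uE _]]; first by rewrite andbC.
rewrite /bern big_mkcond; apply: eq_bigr => e _; rewrite /triple_prob.
by case: ifPn => // eT; rewrite ifN ?subr0 //; apply: contra eT => /uE.
Qed.

(** Even and odd positions in an enumeration of [V] give the two halves. *)
Lemma loose_Hamilton_halves (V : finType) : ~~ odd #|V| ->
  exists x y : 'I_(#|V|./2) -> V,
  [/\ injective x, injective y, (forall i j, x i != y j) &
    forall w (E : {set {set V}}), loose_cycle x y w \subset E -> has_loose_Hamilton_cycle E].
Proof.
move=> oV; have V2 : (#|V| = #|V|./2.*2)%N by rewrite even_halfK.
have xb (i : 'I_(#|V|./2)) : (i.*2 < #|V|)%N by rewrite [X in (_ < X)%N]V2 ltn_double.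
have yb (i : 'I_(#|V|./2)) : (i.*2.+1 < #|V|)%N by rewrite [X in (_ < X)%N]V2 ltn_Sdouble.
pose x i := enum_val (Ordinal (xb i)).
pose y i := enum_val (Ordinal (yb i)).
have xI : injective x by move=> i j /enum_val_inj[] /double_inj/ord_inj.
have yI : injective y by move=> i j /enum_val_inj[] /double_inj/ord_inj.
have xy i j : x i != y j by apply/eqP => /enum_val_inj[]; lia.
exists x, y; split=> // w E wE; apply/existsP; exists (loose_cycle x y w); rewrite wE /=.
apply/existsP; exists [ffun i => x (w.1 i)]; apply/existsP; exists [ffun i => y (w.2 i)].
apply/and5P; split.
- by apply/injectiveP => i j; rewrite !ffunE => /xI/perm_inj.
- by apply/injectiveP => i j; rewrite !ffunE => /yI/perm_inj.
- by apply/forallP => i; apply/forallP => j; rewrite !ffunE xy.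
- apply/forallP => v; have [k vE] : exists k : 'I_(#|V|), v = enum_val k.
    by exists (enum_rank v); rewrite enum_rankK.
  have kb : (k./2 < #|V|./2)%N by have := ltn_ord k; lia.
  apply/orP; case: (boolP (odd k)) => ok; [right|left]; apply/codomP.
    exists (w.2^-1%g (Ordinal kb)); rewrite ffunE permKV vE; congr enum_val.
    by apply: ord_inj; rewrite /= -[LHS]odd_double_half ok.
  exists (w.1^-1%g (Ordinal kb)); rewrite ffunE permKV vE; congr enum_val.
  by apply: ord_inj; rewrite /= -[LHS]odd_double_half (negbTE ok).
- by apply/eqP; apply: eq_imset => i; rewrite /loose_edge !ffunE.
Qed.
End Probability.

(** * Convergence of the probabilities *)

Section Asymptotics.
Local Open Scope ring_scope.
Variable R : realType.

(** [65 * 8] comes from [spread_lemma] at [u.+1], where [8 ^ u] is at most the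
binary logarithm of [n], and [4] from [n = 2m]. *)
Definition hitting_constant : R := 65 * 8 * (4 * (8 * expR 1 ^+ 2)) / ln 2.

Lemma ln2_gt0 : 0 < ln 2 :> R.
Proof. by rewrite ln_gt0 // ltr1n. Qed.

Lemma Pr_H3_le1 n (p : R) (Q : pred {set {set 'I_n}}) :
  0 <= p <= 1 -> Pr_H3 p Q <= 1.
Proof.
move=> p01; rewrite Pr_H3_bern -[leRHS](sum_bern (@triple_prob R n p)) [leRHS](bigID Q) /= lerDl.
apply: sumr_ge0 => E _; apply: bern_ge0 => e.
by rewrite /triple_prob; case: ifP => // _; rewrite lexx ler01.
Qed.

(** With [t] the binary logarithm of [n], [8 ^ u.+1] lies above [t], so that the
cycles are small enough for [spread_lemma], and below [8 * t], so that a density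
of order [ln n / n ^ 2] is enough. *)
Lemma Pr_loose_Hamilton_ge n (p : R) (u := trunc_log 8 (trunc_log 2 n)) :
  (3 < n)%N -> ~~ odd n -> 0 <= p <= 1 ->
  hitting_constant * ln n%:R / n%:R ^+ 2 <= p ->
  1 - (2 ^+ u)^-1 <= Pr_H3 p (@has_loose_Hamilton_cycle 'I_n).
Proof.
move=> n3 oddn p01 Kp; set t := trunc_log 2 n in u *.
have nE : (n = (#|'I_n|./2).*2)%N by rewrite card_ord even_halfK.
have m1 : (1 < #|'I_n|./2)%N by lia.
have [|x [y [xI yI xy hasL]]] := @loose_Hamilton_halves 'I_n; first by rewrite card_ord.
have sp := loose_cycle_spread R xI yI xy m1.
have t0 : (0 < t)%N by rewrite trunc_log_gt0 /=; lia.
have ut : (8 ^ u <= t)%N by apply: trunc_logP.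
have tln : t%:R * ln 2 <= ln n%:R :> R.
  rewrite mulr_natl -lnXn ?ltr0n // ler_ln ?posrE ?exprn_gt0 ?ltr0n //; last by lia.
  by rewrite -natrX ler_nat trunc_logP //; lia.
have tp01 (e : {set 'I_n}) : 0 <= triple_prob p e <= 1.
  by rewrite /triple_prob; case: ifP => // _; rewrite lexx ler01.
have c0 : 0 <= 8 * expR 1 ^+ 2 :> R by rewrite mulr_ge0 ?exprn_ge0 ?expR_ge0.
have dens_ge0 (e : {set 'I_n}) : 0 <= edge_density (8 * expR 1 ^+ 2) e :> R.
  by rewrite /edge_density; case: ifP => // _; rewrite divr_ge0 ?exprn_ge0.
have dens_le (e : {set 'I_n}) :
    65 * 8 ^+ u.+1 * edge_density (8 * expR 1 ^+ 2) e <= triple_prob p e.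
  rewrite /edge_density /triple_prob; case: ifP => _; last by rewrite mulr0.
  apply: le_trans Kp; rewrite /hitting_constant; move: (8 * expR 1 ^+ 2) c0 => c c0.
  have -> : (n%:R : R) ^+ 2 = 4 * (#|'I_n|./2)%:R ^+ 2.
    by rewrite [in LHS]nE -muln2 natrM; ring.
  set M := (#|'I_n|./2)%:R ^+ 2.
  have M0 : 0 < M :> R by rewrite exprn_gt0 // ltr0n ltnW.
  have : 8 ^+ u.+1 * ln 2 <= 8 * ln n%:R :> R.
    rewrite exprS -mulrA ler_wpM2l //; apply: le_trans tln.
    by rewrite ler_wpM2r ?(ltW ln2_gt0) // -natrX ler_nat.
  rewrite -ler_pdivlMr ?ln2_gt0 // => le8.
  have -> : 65 * 8 * (4 * c) / ln 2 * ln n%:R / (4 * M) =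
      65 * (8 * ln n%:R / ln 2) * (c / M) :> R.
    by field; rewrite !gt_eqF // ln2_gt0.
  by rewrite ler_wpM2r ?ler_wpM2l // divr_ge0 // ltW.
have size_le w : w \in [set: _] -> (#|loose_cycle x y w| <= 2 ^ 8 ^ u.+1)%N.
  move=> _; apply: leq_trans (leq_imset_card _ _) _; rewrite card_ord.
  have : (n < 2 ^ t.+1)%N by apply: trunc_log_ltn.
  have : (2 ^ t.+1 <= 2 ^ 8 ^ u.+1)%N by rewrite leq_exp2l // trunc_log_ltn.
  lia.
have tp1 (e : {set 'I_n}) : triple_prob p e <= 1 by case/andP: (tp01 e).
have := spread_lemma dens_ge0 dens_le tp1 sp size_le isT.
have -> : #|[set: {perm 'I_(#|'I_n|./2)} * {perm 'I_(#|'I_n|./2)}]|%:R =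
    (#|'I_n|./2)`!%:R ^+ 2 :> R.
  by rewrite cardsT card_prod !card_Sn natrM.
rewrite mulrC ler_pM2l ?exprn_gt0 ?ltr0n ?fact_gt0 // exprS invfM mulrA divff // mul1r => miss.
rewrite Pr_H3_bern lerBlDr -[leLHS](sum_bern (@triple_prob R n p)) (bigID (@has_loose_Hamilton_cycle 'I_n)) /=.
rewrite lerD2l; apply: le_trans miss; rewrite /miss_prob.
rewrite big_mkcond [leRHS]big_mkcond /=; apply: ler_sum => E _.
case: ifP => [nE'|_]; last by case: ifP => // _; exact: bern_ge0.
rewrite ifT //; apply/forallP => w; apply/implyP => _.
by apply: contra nE' => /hasL.
Qed.
End Asymptotics.

Local Open Scope classical_set_scope.
Local Open Scope ring_scope.

Lemma cvg_to1_of_trunc_log (R : realType) (f : nat -> R) :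
  (\forall n \near \oo, (4 %| n)%N ->
     1 - (2 ^+ trunc_log 8 (trunc_log 2 n))^-1 <= f n <= 1) ->
  f n @[n --> within [set n : nat | (4 %| n)%N]%classic \oo] --> (1 : R).
Proof.
move=> h; apply/cvgrPdist_le => eps eps0.
have [U Ueps] : exists U : nat, (2 ^+ U)^-1 <= eps.
  exists (Num.bound eps^-1); rewrite invf_ple ?posrE ?exprn_gt0 //.
  apply: ltW; apply: lt_le_trans (archi_boundP _) _; first by rewrite invr_ge0 ltW.
  by rewrite -natrX ler_nat ltnW // ltn_expl.
rewrite near_withinE; near=> n => n4.
have /andP[lo hi] : 1 - (2 ^+ trunc_log 8 (trunc_log 2 n))^-1 <= f n <= 1.
  by move: n4; near: n.
have Un : (U <= trunc_log 8 (trunc_log 2 n))%N.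
  have nbig : (2 ^ 8 ^ U <= n)%N by near: n; exact: nbhs_infty_ge.
  by apply: trunc_log_max => //; apply: trunc_log_max.
rewrite ger0_norm ?subr_ge0 //; apply: le_trans Ueps.
apply: (@le_trans _ _ (2 ^+ trunc_log 8 (trunc_log 2 n))^-1); first by lra.
by rewrite lef_pV2 ?posrE ?exprn_gt0 // ler_weXn2l // ler1n.
Unshelve. all: by end_near.
Qed.

Theorem theorem1 (R : realType) :
  exists K : R, 0 < K /\
    forall p : nat -> R,
      (forall n : nat, 0 <= p n <= 1) ->
      (\forall n \near \oo,
         (4 %| n)%N -> K * ln (n%:R : R) / n%:R ^+ 2 <= p n) ->
      Pr_H3 (p n) (@has_loose_Hamilton_cycle 'I_n)
        @[n --> within [set n : nat | (4 %| n)%N] \oo] --> (1 : R).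
Proof.
exists (hitting_constant R); split.
  by rewrite /hitting_constant divr_gt0 ?ln2_gt0 // !mulr_gt0 // exprn_gt0 // expR_gt0.
move=> p p01 pK; apply: cvg_to1_of_trunc_log; near=> n => n4.
have n3 : (3 < n)%N by near: n; exact: nbhs_infty_gt.
have Kn : (4 %| n)%N -> hitting_constant R * ln n%:R / n%:R ^+ 2 <= p n.
  by near: n.
have evenn : ~~ odd n by lia.
by rewrite Pr_H3_le1 // andbT Pr_loose_Hamilton_ge // Kn.
Unshelve. all: by end_near.
Qed.
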